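(* There is a function $\varepsilon$ of the positive integer $q$ with $\varepsilon(q)\to 0$ as $q\to\infty$ such that, for every finite projective plane $\Pi_q$ (not necessarily Desarguesian) of order $q\ge 2$, the minimum size of a saturating set $S$ in $\Pi_q$ satisfies $$\min |S| \le (\sqrt{3}+\varepsilon(q))\sqrt{q\ln q}.$$
   Context: A projective plane of order $q$ has $q^2+q+1$ points and $q^2+q+1$ lines, with $q+1$ points on every line and $q+1$ lines through every point. A set $S$ of points of $\Pi_q$ is called saturating if every point of $\Pi_q$ outside $S$ is collinear with two distinct points of $S$ (i.e. lies on a line containing two distinct points of $S$). *)

(* Defs.v *)
From mathcomp Require Import all_boot.

Set Implicit Arguments.
Unset Strict Implicit.
Unset Printing Implicit Defensive.

Section ProjectivePlane.
Variables (P L : finType) (inc : P -> L -> bool).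

(* The nondegeneracy condition is the existence of a quadrangle: four points
   of which no three are on a common line. *)
Record projective_plane : Prop := ProjectivePlane {
  join_uniq : forall x y : P, x != y -> exists! l : L, inc x l /\ inc y l;
  meet_uniq : forall l m : L, l != m -> exists! x : P, inc x l /\ inc x m;
  quadrangle : exists Q : {set P},
    #|Q| = 4 /\ forall l : L, #|[set x in Q | inc x l]| <= 2
}.

(* The values [#|P| = #|L| = q ^ 2 + q + 1] and the [q + 1] lines through every
   point follow from [projective_plane] and this condition. *)
Definition has_order (q : nat) : Prop :=
  forall l : L, #|[set x | inc x l]| = q.+1.

Definition saturating (S : {set P}) : bool :=
  [forall x, (x \notin S) ==>
    [exists y in S, exists z in S, exists l,
       [&& y != z, inc x l, inc y l & inc z l]]].

Lemma saturatingT : saturating [set: P].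
Proof. by apply/forallP => x; rewrite inE. Qed.

(* The minimum is attained since [[set: P]] is saturating. *)
Definition min_saturating_size : nat :=
  #|[arg min_(S < [set: P] | saturating S) #|S|]|.

Lemma min_saturating_sizeP :
  (exists2 S, saturating S & #|S| = min_saturating_size) /\
  (forall S, saturating S -> min_saturating_size <= #|S|).
Proof.
rewrite /min_saturating_size; case: arg_minnP; first exact: saturatingT.
by move=> S satS minS; split; [exists S | move=> A /minS].
Qed.

End ProjectivePlane.

(* Main.v *)
Require Import Defs.
From mathcomp Require Import all_boot all_order all_algebra.
From mathcomp Require Import all_classical all_reals all_analysis.
From mathcomp Require Import zify ring lra.
Import Order.TTheory GRing.Theory Num.Theory.
Import numFieldNormedType.Exports.

Set Implicit Arguments.
Unset Strict Implicit.

(** Build [S] greedily. If [x] is not covered by the secants of a [k]-set [S],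
    then the [k] lines joining [x] to [S] are distinct, and adding to [S] any of
    the other [q - 1] points on one of them covers [x]. By double counting, some
    new point covers at least a proportion [k (q - 1) / (q^2 + q + 1)] of the
    uncovered points, so that after [k] steps at most about
    [q^2 exp (- k^2 / (2 q))] points remain uncovered. For
    [k = sqrt (3 q ln q)] this is [O(sqrt q)], and we may simply add all the
    remaining points to [S]. *)

Section Uncovered.
Local Open Scope nat_scope.
Variables (P L : finType) (inc : P -> L -> bool).
Implicit Types (S T : {set P}) (x y r : P) (l m : L).

(** * Covered and uncovered points *)

Definition covered S x : bool :=
  [exists y in S, exists z in S, exists l,
     [&& y != z, inc x l, inc y l & inc z l]].

Definition uncovered S : {set P} := [set x | (x \notin S) && ~~ covered S x].

Lemma coveredP S x :
  reflect (exists y z l,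
      [/\ y \in S, z \in S & [&& y != z, inc x l, inc y l & inc z l]])
          (covered S x).
Proof.
apply: (iffP exists_inP) => [[y yS /exists_inP[z zS /existsP[l H]]]|].
  by exists y, z, l.
move=> [y [z [l [yS zS H]]]]; exists y => //.
by apply/exists_inP; exists z => //; apply/existsP; exists l.
Qed.

Lemma covered_subset S T x : S \subset T -> covered S x -> covered T x.
Proof.
move=> /fintype.subsetP ST /coveredP[y [z [l [yS zS H]]]].
by apply/coveredP; exists y, z, l; split; rewrite ?ST.
Qed.

Lemma uncovered_subset S T :
  S \subset T -> uncovered T \subset uncovered S.
Proof.
move=> ST; apply/fintype.subsetP => x; rewrite !inE => /andP[xT xcT].
by rewrite (contra (fintype.subsetP ST x)) // (contra (covered_subset ST)).
Qed.

Lemma saturating_setU_uncovered S : saturating inc (S :|: uncovered S).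
Proof.
apply/forallP => x; apply/implyP; rewrite !inE negb_or => /andP[xS].
rewrite xS /= negbK; apply: covered_subset; exact: finset.subsetUl.
Qed.

Lemma min_saturating_size_le S :
  min_saturating_size inc <= #|S| + #|uncovered S|.
Proof.
apply: leq_trans ((min_saturating_sizeP inc).2 _ (saturating_setU_uncovered S)) _.
exact: leq_card_setU.
Qed.

(** For [y] in [S] and [x] uncovered, these are the points of the line [xy] whose addition to [S]
    covers [x]. *)
Definition third_points x y : {set P} :=
  [set r | [&& r != x, r != y & [exists l, [&& inc x l, inc y l & inc r l]]]].

(** * Incidence counts in a plane of order [q], and the greedy step *)

Hypothesis plane : projective_plane inc.

Lemma join_exists x y : x != y -> exists l, inc x l && inc y l.
Proof. by move=> /(join_uniq plane)[l [[xl yl] _]]; exists l; rewrite xl yl. Qed.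

Lemma join_eq x y l m : x != y -> inc x l -> inc y l -> inc x m -> inc y m -> l = m.
Proof.
move=> /(join_uniq plane)[n [_ nuniq]] xl yl xm ym.
by rewrite -(nuniq l) // -(nuniq m).
Qed.

(** Two points of the quadrangle provide a line, which cannot contain all four. *)
Lemma antiflag_exists : exists x m, ~~ inc x m.
Proof.
have [Q [Q4 Q2]] := quadrangle plane.
have /card_gt1P[x [y [xQ yQ xy]]] : 1 < #|Q| by rewrite Q4.
have [l _] := join_exists xy.
have [z zQ zl] : exists2 z, z \in Q & ~~ inc z l.
  apply/exists_inP; apply: contraT; rewrite negb_exists_in => /forall_inP H.
  have := Q2 l; rewrite (_ : [set x in Q | inc x l] = Q) ?Q4 //.
  by apply/finset.setP => z; rewrite inE; case: (boolP (z \in Q)) => //= /H /negPn.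
by exists z, l.
Qed.

Variable q : nat.
Hypothesis order_q : has_order inc q.

Lemma card_third_points x y : x != y -> q.-1 <= #|third_points x y|.
Proof.
move=> xy; have [l /andP[xl yl]] := join_exists xy.
have := cardsD1 x [set r | inc r l]; rewrite order_q inE xl.
have := cardsD1 y ([set r | inc r l] :\ x); rewrite !inE yl eq_sym xy /= => -> [->].
rewrite /=; apply/subset_leq_card/fintype.subsetP => r; rewrite !inE.
move=> /and3P[-> -> rl] /=; apply/existsP; exists l; exact/and3P.
Qed.

(** For an antiflag [(x, m)], each point other than [x] is on a line joining [x] to one of the
    [q + 1] points of [m], and each such line has [q] points besides [x]. *)
Lemma card_points_le : #|P| <= q ^ 2 + q + 1.
Proof.
have [x [m xm]] := antiflag_exists.
pose line p := [set y | (y != x) && [exists l, [&& inc x l, inc p l & inc y l]]].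
have card_line p : inc p m -> #|line p| <= q.
  move=> pm; have xp : x != p by apply: contraNneq xm => ->.
  have [l /andP[xl pl]] := join_exists xp.
  have := cardsD1 x [set r | inc r l]; rewrite order_q inE xl => -[->].
  apply/subset_leq_card/fintype.subsetP => y; rewrite !inE.
  move=> /andP[-> /existsP[l' /and3P[xl' pl' yl']]].
  by rewrite (join_eq xp xl pl xl' pl').
have cover : [set: P] \subset x |: \bigcup_(p in [set p | inc p m]) line p.
  apply/fintype.subsetP => y _; rewrite !inE; have [//|yx /=] := eqVneq y x.
  have [l /andP[yl xl]] := join_exists yx.
  have lm : l != m by apply: contraNneq xm => <-.
  have [p [[pl pm] _]] := meet_uniq plane lm.
  apply/finset.bigcupP; exists p; rewrite inE // yx; apply/existsP; exists l.
  exact/and3P.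
rewrite -cardsT; apply: leq_trans (subset_leq_card cover) _.
apply: leq_trans (leq_card_setU _ _) _; rewrite cards1 addnC leq_add2r.
apply: (@leq_trans (\sum_(p in [set p | inc p m]) #|line p|)).
  elim/big_rec2: _ => [|p n A _ IH]; first by rewrite cards0.
  by apply: leq_trans (leq_card_setU _ _) _; rewrite leq_add2l.
apply: (@leq_trans (\sum_(p in [set p | inc p m]) q)).
  by apply: leq_sum => p; rewrite inE; exact: card_line.
by rewrite sum_nat_const order_q mulSn addnC expnS expn1.
Qed.

(** No line through an uncovered [x] meets [S] twice, so the sets [third_points x y] for [y] in [S]
    are pairwise disjoint and avoid [S]; each has at least [q - 1] points. *)
Lemma card_covering_points S x : x \in uncovered S ->
  #|S| * q.-1 <= #|[set r | (r \notin S) && (x \notin uncovered (r |: S))]|.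
Proof.
rewrite inE => /andP[xS xS']; set A := [set r | _].
have aligned y z l : y \in S -> z \in S -> inc x l -> inc y l -> inc z l -> y = z.
  move=> yS zS xl yl zl; apply/eqP; apply: contraNT xS' => yz.
  by apply/coveredP; exists y, z, l; split => //; apply/and4P.
have subA y : y \in S -> third_points x y \subset A.
  move=> yS; apply/fintype.subsetP => r; rewrite !inE.
  move=> /and3P[rx ry /existsP[l /and3P[xl yl rl]]].
  apply/andP; split.
    by apply: contra ry => rS; rewrite (aligned y r l).
  rewrite negb_and !negbK; apply/orP; right.
  by apply/coveredP; exists y, r, l; rewrite !inE eqxx yS orbT eq_sym ry xl yl rl.
rewrite -sum_nat_const.
apply: (@leq_trans (\sum_(y in S) #|third_points x y|)).
  by apply: leq_sum => y yS; apply: card_third_points; apply: contraNneq xS => ->.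
(* Disjointness enters as a double count: each [r] in [A] is a third point for at most one [y]. *)
under eq_bigr => y yS do rewrite -sum1_card.
rewrite (exchange_big_dep (mem A)) /=; last first.
  by move=> y r yS; exact: (fintype.subsetP (subA y yS)).
rewrite -[leqRHS]sum1_card; apply: leq_sum => r rA.
rewrite sum1dep_card; apply/card_le1P => y; rewrite !inE => /andP[yS].
move=> /and3P[rx ry /existsP[l /and3P[xl yl rl]]] z; rewrite !inE.
apply/idP/eqP => [/andP[zS /and3P[_ _ /existsP[l' /and3P[xl' zl' rl']]]]|->].
  by apply/esym/(aligned y z l) => //; rewrite (join_eq rx rl xl rl' xl').
by rewrite yS rx ry; apply/existsP; exists l; apply/and3P.
Qed.

(** Count the pairs of an uncovered [x] and a new point [r] that covers it: the best [r] does at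
    least as well as the average over at most [q ^ 2 + q + 1] candidates. *)
Lemma greedy_point S : uncovered S != finset.set0 ->
  exists2 r, r \notin S &
    #|uncovered S| * (#|S| * q.-1) <=
      (q ^ 2 + q + 1) * (#|uncovered S| - #|uncovered (r |: S)|).
Proof.
move=> /set0Pn[x0 x0U].
(* This makes the range of the maximum below nonempty. *)
have x0S : x0 \notin S by move: x0U; rewrite inE => /andP[].
pose gain r := #|uncovered S :\: uncovered (r |: S)|.
have gainE r : gain r = #|uncovered S| - #|uncovered (r |: S)|.
  rewrite /gain cardsDS //; apply: uncovered_subset; exact: finset.subsetUr.
case: (@arg_maxnP _ x0 (fun r => r \notin S) gain x0S) => r rS rmax.
exists r => //; rewrite -gainE -sum_nat_const.
apply: leq_trans; first by apply: leq_sum => x; exact: card_covering_points.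
under eq_bigr => x xU do rewrite -sum1_card.
rewrite (exchange_big_dep (fun r => r \notin S)) /=; last first.
  by move=> x r' xU; rewrite inE => /andP[].
apply: (@leq_trans (\sum_(r' | r' \notin S) gain r)).
  apply: leq_sum => r' r'S; apply: leq_trans (rmax r' r'S).
  rewrite sum1dep_card; apply/subset_leq_card/fintype.subsetP => x.
  by rewrite !inE r'S andbC.
rewrite sum_nat_const leq_mul2r; apply/orP; right.
apply: leq_trans card_points_le; exact: max_card.
Qed.

End Uncovered.

Local Open Scope classical_set_scope.
Local Open Scope ring_scope.

(** * Real estimates for the greedy construction *)

Section RealBound.
Variable R : realType.

(** Adding a point to a [j]-set multiplies the uncovered count by at most [1 - (q - 1) j / Q], hence
    by at most [expR (- (q - 1) j / Q)]; the exponents sum over [j < k] to the one stated. The first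
    alternative records that nothing was left to cover at an earlier step. *)
Lemma greedy_set (P L : finType) (inc : P -> L -> bool) (q k : nat) :
  projective_plane inc -> has_order inc q -> (0 < q)%N ->
  let Q := (q ^ 2 + q + 1)%:R : R in
  (min_saturating_size inc <= k)%N \/
  exists2 S : {set P}, #|S| = k &
    #|uncovered inc S|%:R <=
      Q * expR (- ((q%:R - 1) / Q * (k%:R * (k%:R - 1) / 2))).
Proof.
move=> plane order_q q0 Q.
have Q0 : 0 < Q by rewrite ltr0n addn1.
elim: k => [|k [IH|[S Sk IH]]].
- right; exists finset.set0; first by rewrite cards0.
  rewrite !mul0r mulr0 oppr0 expR0 mulr1 ler_nat.
  apply: leq_trans (max_card _) _; exact: (card_points_le plane order_q).
- by left; apply: leq_trans IH _.
have [U0|U0] := eqVneq (uncovered inc S) finset.set0.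
  left; apply: leq_trans (min_saturating_size_le inc S) _.
  by rewrite U0 cards0 addn0 Sk.
right; have [r rS step] := greedy_point plane order_q U0.
exists (r |: S); first by rewrite cardsU1 rS Sk.
have Ule : (#|uncovered inc (r |: S)| <= #|uncovered inc S|)%N.
  by apply/subset_leq_card/uncovered_subset/finset.subsetUr.
move: step; rewrite Sk -(ler_nat R) !natrM natrB // -/Q -subn1 natrB //.
set u : R := #|uncovered inc S|%:R; set u' : R := #|_|%:R => step.
have {step} step : u' <= u * (1 - (q%:R - 1) / Q * k%:R).
  rewrite -(ler_pM2l Q0).
  have -> : Q * (u * (1 - (q%:R - 1) / Q * k%:R)) = Q * u - u * (k%:R * (q%:R - 1)).
    by field; rewrite gt_eqF.
  lra.
apply: (le_trans step).
apply: (@le_trans _ _ (u * expR (- ((q%:R - 1) / Q * k%:R)))).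
  apply: ler_wpM2l; first exact: ler0n.
  exact: expR_ge1Dx.
apply: (le_trans (ler_wpM2r (expR_ge0 _) IH)).
rewrite -[leLHS]mulrA -expRD le_eqVlt; apply/orP; left; apply/eqP.
congr (_ * expR _); rewrite -natr1; field; by rewrite gt_eqF.
Qed.

(** Here [t] stands for [ln q]. The constant 4 absorbs two losses: at most 1 from replacing
    [k (k - 1)] by [3 q t - 2 q], and at most 3 from replacing [q (q - 1)] by [q ^ 2 + q + 1], using
    [t <= q]. *)
Lemma greedy_exponent_ge (q t s k : R) :
  2 <= q -> 0 <= t <= q -> 0 <= s -> s ^+ 2 = 3 * (q * t) -> 1 <= k -> s <= k ->
  3 / 2 * t - 4 <= (q - 1) / (q ^+ 2 + q + 1) * (k * (k - 1) / 2).
Proof.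
move=> q2 /andP[t0 tq] s0 s2 k1 sk.
have Q0 : 0 < q ^+ 2 + q + 1 by nra.
have sq : s <= 2 * q by nra.
have kk : 3 * (q * t) - 2 * q <= k * (k - 1) by nra.
rewrite [leRHS]mulrAC ler_pdivlMr //.
apply: (@le_trans _ _ ((q - 1) * ((3 * (q * t) - 2 * q) / 2))); last first.
  by apply: ler_wpM2l; lra.
nra.
Qed.

Lemma expR_half_ln (x : R) : 0 < x -> expR (ln x / 2) = Num.sqrt x.
Proof.
move=> x0; rewrite -[RHS](_ : Num.sqrt (expR (ln x / 2) ^+ 2) = _).
  by rewrite sqrtr_sqr ger0_norm // expR_ge0.
by rewrite -expRM_natl mulrC divfK ?pnatr_eq0 // lnK.
Qed.

(** The factor 3 under the root makes the exponential at most [expR 4 / (q sqrt q)], and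
    [Q <= 2 q ^ 2] for [q >= 2]. *)
Lemma greedy_remainder_le (q k : nat) : (2 <= q)%N ->
  Num.sqrt (3 * (q%:R * ln q%:R)) <= k.+1%:R :> R ->
  forall Q : R, Q = (q ^ 2 + q + 1)%:R ->
  Q * expR (- ((q%:R - 1) / Q * (k.+1%:R * (k.+1%:R - 1) / 2))) <=
    2 * expR 4 * Num.sqrt q%:R.
Proof.
move=> q2 sk Q Qdef.
have q2R : 2 <= q%:R :> R by rewrite ler_nat.
have QE : Q = q%:R ^+ 2 + q%:R + 1 by rewrite Qdef !natrD natrX.
have q0 : 0 < q%:R :> R by lra.
have t0 : 0 <= ln q%:R :> R by rewrite ln_ge0 //; lra.
have tq : ln q%:R <= q%:R :> R.
  have := @expR_ge1Dx R (ln q%:R); rewrite lnK; last by rewrite posrE.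
  lra.
have sq0 : 0 < Num.sqrt q%:R :> R by rewrite sqrtr_gt0.
have sqE : Num.sqrt q%:R ^+ 2 = q%:R :> R by rewrite sqr_sqrtr // ltW.
apply: (@le_trans _ _ (Q * expR (4 - 3 / 2 * ln q%:R))).
  apply: ler_wpM2l; first by rewrite Qdef ler0n.
  rewrite ler_expR lerNl opprB QE.
  apply: (@greedy_exponent_ge _ _ (Num.sqrt (3 * (q%:R * ln q%:R)))) => //.
  - by rewrite t0 tq.
  - by rewrite sqr_sqrtr // mulr_ge0 // mulr_ge0 // ltW.
  - by rewrite ler1n.
have -> : 4 - 3 / 2 * ln q%:R = 4 - (ln q%:R + ln q%:R / 2) :> R by field.
rewrite expRD expRN expRD expR_half_ln // lnK ?posrE //.
rewrite mulrA ler_pdivrMr; last by rewrite mulr_gt0.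
have -> : 2 * expR 4 * Num.sqrt q%:R * (q%:R * Num.sqrt q%:R) =
  2 * q%:R * expR 4 * Num.sqrt q%:R ^+ 2 :> R by ring.
rewrite sqE mulrAC ler_wpM2r ?expR_ge0 // QE; nra.
Qed.

Lemma cvg_div_sqrt_ln (C : R) : C / Num.sqrt (ln q%:R) @[q --> \oo] --> (0 : R).
Proof.
apply/cvgr0Pnorm_lt => e e0.
(* The condition [|C| / sqrt (ln q) < e] solved for [q], with some slack. *)
exists (Num.truncn (expR ((C / e) ^+ 2 + 1))).+1 => // q /= Nq.
have lt_q : expR ((C / e) ^+ 2 + 1) < q%:R.
  by apply: lt_le_trans (truncnS_gt _) _; rewrite ler_nat.
have q0 : 0 < q%:R :> R by exact: lt_trans (expR_gt0 _) lt_q.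
have lt_ln : (C / e) ^+ 2 < ln q%:R.
  by apply: (@lt_trans _ _ ((C / e) ^+ 2 + 1)); rewrite ?ltrDl // -ltr_expR lnK.
have ln0 : 0 < ln q%:R :> R by exact: le_lt_trans (sqr_ge0 _) lt_ln.
rewrite normrM normfV (ger0_norm (sqrtr_ge0 _)).
rewrite ltr_pdivrMr ?sqrtr_gt0 // mulrC -ltr_pdivrMr //.
by rewrite -{1}(gtr0_norm e0) -normf_div -sqrtr_sqr ltr_sqrt.
Qed.

End RealBound.

Theorem theorem1p6 (R : realType) :
  exists eps : nat -> R,
    (eps q @[q --> \oo] --> (0 : R)) /\
    forall (q : nat) (P L : finType) (inc : P -> L -> bool),
      (2 <= q)%N -> projective_plane inc -> has_order inc q ->
      (min_saturating_size inc)%:R <=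
        (Num.sqrt 3 + eps q) * Num.sqrt (q%:R * ln (q%:R : R)).
Proof.
(* Beyond the main term, rounding costs 1, at most [sqrt q], and the leftover points cost
   [2 expR 4 sqrt q]; the sum is divided by [sqrt (q ln q)]. *)
exists (fun q => (2 * expR 4 + 1) / Num.sqrt (ln q%:R)).
split; first exact: cvg_div_sqrt_ln.
move=> q P L inc q2 plane order_q.
have q2R : 2 <= q%:R :> R by rewrite ler_nat.
have lnq : 0 < ln q%:R :> R by rewrite ln_gt0 //; lra.
pose s : R := Num.sqrt (3 * (q%:R * ln q%:R)).
have s0 : 0 <= s by exact: sqrtr_ge0.
(* The greedy construction takes [k.+1] steps, which is positive and exceeds [s] by at most 1. *)
pose k := Num.truncn s.
have /andP[ks sk] : k%:R <= s < k.+1%:R by exact: truncn_itv.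
have sqrt1 : 1 <= Num.sqrt q%:R :> R by rewrite -[leLHS]sqrtr1 ler_sqrt //; lra.
have e0 := expR_ge0 (4 : R).
apply: (@le_trans _ _ (s + 1 + 2 * expR 4 * Num.sqrt q%:R)); last first.
  have -> : (Num.sqrt 3 + (2 * expR 4 + 1) / Num.sqrt (ln q%:R)) *
      Num.sqrt (q%:R * ln q%:R) = s + (2 * expR 4 + 1) * Num.sqrt q%:R.
    by rewrite /s !sqrtrM ?ler0n //; field; rewrite gt_eqF ?sqrtr_gt0.
  lra.
have k1s : k.+1%:R <= s + 1 by rewrite -natr1 lerD2r.
have q0 : (0 < q)%N by lia.
have [le_k|[S Sk US]] := greedy_set R k.+1 plane order_q q0.
  apply: (@le_trans _ _ k.+1%:R); first by rewrite ler_nat.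
  by nra.
apply: (@le_trans _ _ (#|S| + #|uncovered inc S|)%:R).
  by rewrite ler_nat min_saturating_size_le.
rewrite natrD Sk; apply: lerD => //.
exact: le_trans US (greedy_remainder_le q2 (ltW sk) erefl).
Qed.
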